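(* Let $(\mathcal{L},\phi,\xi,\eta,g)$ be the 3-dimensional almost paracontact almost paracomplex Riemannian manifold constructed on a 3-dimensional real connected Lie group $\mathcal{L}$ with basis of left-invariant vector fields $\{E_0,E_1,E_2\}$ as described in the context. For each $s\in\{1,4,5,8,9,10,11\}$, the manifold $(\mathcal{L},\phi,\xi,\eta,g)$ belongs to the basic class $\mathcal{F}_s$ if and only if the Lie algebra $\mathfrak{l}$ of $\mathcal{L}$ is determined by the following commutators, where $\alpha,\beta$ are arbitrary real parameters: \begin{itemize} \item $\mathcal{F}_1$: $[E_0,E_1]=0$, $[E_0,E_2]=0$, $[E_1,E_2]=\alpha E_1-\beta E_2$; \item $\mathcal{F}_4$: $[E_0,E_1]=\alpha E_2$, $[E_0,E_2]=\alpha E_1$, $[E_1,E_2]=0$; \item $\mathcal{F}_5$: $[E_0,E_1]=\alpha E_1$, $[E_0,E_2]=\alpha E_2$, $[E_1,E_2]=0$; \item $\mathcal{F}_8$: $[E_0,E_1]=\alpha E_2$, $[E_0,E_2]=-\alpha E_1$, $[E_1,E_2]=2\alpha E_0$; \item $\mathcal{F}_9$: $[E_0,E_1]=\alpha E_1$, $[E_0,E_2]=-\alpha E_2$, $[E_1,E_2]=0$; \item $\mathcal{F}_{10}$: $[E_0,E_1]=-\alpha E_2$, $[E_0,E_2]=\alpha E_1$, $[E_1,E_2]=0$; \item $\mathcal{F}_{11}$: $[E_0,E_1]=\alpha E_0$, $[E_0,E_2]=\beta E_0$, $[E_1,E_2]=0$. \end{itemize} Moreover, the parameters are related to the coefficients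 of $F$ in the respective class by: $\mathcal{F}_1$: $\alpha=\frac12\theta_1$, $\beta=\frac12\theta_2$; $\mathcal{F}_4$: $\alpha=\frac12\theta_0$; $\mathcal{F}_5$: $\alpha=\frac12\theta^*_0$; $\mathcal{F}_8$: $\alpha=\lambda$; $\mathcal{F}_9$: $\alpha=\mu$; $\mathcal{F}_{10}$: $\alpha=\frac12\nu$; $\mathcal{F}_{11}$: $\alpha=\omega_2$, $\beta=\omega_1$.
   Context: Let $\mathcal{L}$ be a 3-dimensional real connected Lie group with Lie algebra $\mathfrak{l}$, and let $\{E_0,E_1,E_2\}$ be a basis of left-invariant vector fields. Define left-invariant tensors $\phi$ (type $(1,1)$), $\xi$ (vector field), $\eta$ (1-form), $g$ (Riemannian metric) by $\phi E_0=0$, $\phi E_1=E_2$, $\phi E_2=E_1$, $\xi=E_0$, $\eta(E_0)=1$, $\eta(E_1)=\eta(E_2)=0$, $g(E_i,E_j)=\delta_{ij}$. Then $(\mathcal{L},\phi,\xi,\eta,g)$ is called an almost paracontact almost paracomplex Riemannian manifold (of dimension 3). Let $\nabla$ be the Levi-Civita connection of $g$, $F(x,y,z)=g((\nabla_x\phi)y,z)$ and $F_{ijk}=F(E_i,E_j,E_k)$. For $x=x^iE_i$, $y=y^iE_i$, $z=z^iE_i$, the manifold belongs to the basic class $\mathcal{F}_s$ if $F=F_s$, where $F_s$ is a tensor of the following form, with real coefficients $\theta_0,\theta_1,\theta_2,\theta_0^*,\lambda,\mu,\nu,\omega_1,\omega_2$: - $F_1(x,y,z)=(x^1\theta_1-x^2\theta_2)(y^1z^1-y^2z^2)$;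 - $F_4(x,y,z)=\frac{\theta_0}{2}\{x^1(y^0z^1+y^1z^0)+x^2(y^0z^2+y^2z^0)\}$; - $F_5(x,y,z)=\frac{\theta^*_0}{2}\{x^1(y^0z^2+y^2z^0)+x^2(y^0z^1+y^1z^0)\}$; - $F_8(x,y,z)=\lambda\{x^1(y^0z^1+y^1z^0)-x^2(y^0z^2+y^2z^0)\}$; - $F_9(x,y,z)=\mu\{x^1(y^0z^2+y^2z^0)-x^2(y^0z^1+y^1z^0)\}$; - $F_{10}(x,y,z)=\nu x^0(y^1z^1-y^2z^2)$; - $F_{11}(x,y,z)=x^0\{\omega_1(y^0z^1+y^1z^0)+\omega_2(y^0z^2+y^2z^0)\}$. Here the coefficients are: $\theta_0=F_{110}+F_{220}$, $\theta_1=F_{111}=-F_{122}$, $\theta_2=F_{222}=-F_{211}$, $\theta^*_0=F_{120}+F_{210}$, $\omega_1=F_{001}$, $\omega_2=F_{002}$; in $\mathcal{F}_8$, $\lambda=F_{110}=-F_{220}$; in $\mathcal{F}_9$, $\mu=F_{120}=-F_{210}$; in $\mathcal{F}_{10}$, $\nu=F_{011}=-F_{022}$. *)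

(* Defs.v *)
From HB Require Import structures.
From mathcomp Require Import all_boot all_order all_algebra.
From mathcomp Require Import all_classical all_reals all_analysis.
From mathcomp Require Import ring.

Set Implicit Arguments.
Unset Strict Implicit.
Unset Printing Implicit Defensive.

Import Order.TTheory GRing.Theory Num.Theory.
Import numFieldNormedType.Exports.

Local Open Scope classical_set_scope.
Local Open Scope ring_scope.

Section Smoothness.
Context {R : realType}.

(* C^k on an open set U; the values of f outside U are irrelevant. *)
Fixpoint Ck (V W : normedModType R) (k : nat) (U : set V) (f : V -> W) : Prop :=
  if k is k'.+1 then
    exists df : V -> V -> W,
      (forall x, U x -> is_diff x f (df x)) /\
      (forall v, Ck k' U (fun x => df x v))
  else forall x, U x -> {for x, continuous f}.

Definition smooth_on (V W : normedModType R) (U : set V) (f : V -> W) : Prop :=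
  forall k, Ck k U f.

Lemma Ck_cst (V W : normedModType R) k (U : set V) (a : W) :
  Ck k U (fun=> a).
Proof.
elim: k a => [|k IH] a /=; first by move=> x _; exact: cst_continuous.
exists (fun _ _ => 0); split => [x _|v]; last exact: IH.
exact: is_diff_cst.
Qed.

Lemma Ck_pred (V W : normedModType R) k (U : set V) (f : V -> W) :
  Ck k.+1 U f -> Ck k U f.
Proof.
elim: k f => [|k IH] f [df [fdf dfk]].
  by move=> x Ux; apply: differentiable_continuous; case: (fdf x Ux).
by exists df; split => // v; apply: IH; exact: dfk.
Qed.

Lemma CkD (V W : normedModType R) k (U : set V) (f g : V -> W) :
  Ck k U f -> Ck k U g -> Ck k U (f \+ g).
Proof.
elim: k f g => [|k IH] f g /=.
  by move=> cf cg x Ux; apply: continuousD; [exact: cf|exact: cg].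
move=> [df [fdf dfk]] [dg [gdg dgk]].
exists (fun x => df x \+ dg x); split => [x Ux|v]; last exact: IH.
by have := fdf x Ux; have := gdg x Ux => ? ?; exact: is_diffD.
Qed.

Lemma CkM (V : normedModType R) k (U : set V) (f g : V -> R) :
  Ck k U (f : V -> R^o) -> Ck k U (g : V -> R^o) ->
  Ck k U ((f \* g) : V -> R^o).
Proof.
elim: k f g => [|k IH] f g.
  by move=> cf cg x Ux; apply: continuousM; [exact: cf|exact: cg].
move=> fk gk; have fk' := Ck_pred fk; have gk' := Ck_pred gk.
case: fk => df [fdf dfk]; case: gk => dg [gdg dgk].
exists (fun x => f x *: dg x + g x *: df x); split => [x Ux|v].
  by have := fdf x Ux; have := gdg x Ux => ? ?; exact: is_diffM.
exact: (CkD (IH _ _ fk' (dgk v)) (IH _ _ gk' (dfk v))).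
Qed.

End Smoothness.

Record chart (R : realType) (n : nat) (M : topologicalType) := Chart {
  chart_dom : set M;
  chart_cod : set 'rV[R]_n;
  chart_map :> M -> 'rV[R]_n;
  chart_inv : 'rV[R]_n -> M;
  chart_dom_open : open chart_dom;
  chart_cod_open : open chart_cod;
  chart_mapP : forall p, chart_dom p -> chart_cod (chart_map p);
  chart_invP : forall u, chart_cod u -> chart_dom (chart_inv u);
  chart_mapK : forall p, chart_dom p -> chart_inv (chart_map p) = p;
  chart_invK : forall u, chart_cod u -> chart_map (chart_inv u) = u;
  chart_map_continuous : forall p, chart_dom p -> {for p, continuous chart_map};
  chart_inv_continuous : forall u, chart_cod u -> {for u, continuous chart_inv}
}.

HB.mixin Record isSmoothManifold (R : realType) (n : nat) M
    of Topological M := {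
  atlas : set (chart R n M);
  atlas_cover : forall p, exists2 c, atlas c & chart_dom c p;
  atlas_compatible : forall c d, atlas c -> atlas d ->
    smooth_on [set u | chart_cod c u /\ chart_dom d (chart_inv c u)]
      (fun u => d (chart_inv c u));
  manifold_hausdorff : hausdorff_space M;
  manifold_second_countable : @second_countable M
}.

#[short(type="smoothManifoldType")]
HB.structure Definition SmoothManifold (R : realType) (n : nat) :=
  { M of isSmoothManifold R n M & Topological M }.

(* [lie_mul_smooth] is smoothness of the multiplication on the product
   manifold, written in product charts. *)
HB.mixin Record isLieGroup (R : realType) (n : nat) G
    of SmoothManifold R n G & Group G := {
  lie_mul_continuous : continuous (fun p : G * G => (p.1 * p.2)%g);
  lie_inv_continuous : continuous (fun p : G => p^-1%g);
  lie_mul_smooth : forall c d e : chart R n G, atlas c -> atlas d -> atlas e ->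
    smooth_on
      [set u : 'rV[R]_n * 'rV[R]_n |
        [/\ chart_cod c u.1, chart_cod d u.2 &
            chart_dom e (chart_inv c u.1 * chart_inv d u.2)%g]]
      (fun u => e (chart_inv c u.1 * chart_inv d u.2)%g);
  lie_inv_smooth : forall c d : chart R n G, atlas c -> atlas d ->
    smooth_on [set u | chart_cod c u /\ chart_dom d (chart_inv c u)^-1%g]
      (fun u => d (chart_inv c u)^-1%g)
}.

#[short(type="lieGroupType")]
HB.structure Definition LieGroup (R : realType) (n : nat) :=
  { G of isLieGroup R n G & SmoothManifold R n G & Group G }.

Section SmoothFunctions.
Context {R : realType} {n : nat} (M : smoothManifoldType R n).

Definition smooth_function : {pred M -> R} := fun f =>
  `[< forall c : chart R n M, atlas c ->
      smooth_on (chart_cod c) ((fun u => f (chart_inv c u)) : _ -> R^o) >].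

Fact smooth_function_subring : subring_closed smooth_function.
Proof.
split=> [|f g /asboolP sf /asboolP sg|f g /asboolP sf /asboolP sg];
  apply/asboolP => c ca k.
- exact: Ck_cst.
- have := CkD (sf c ca k) (CkM (@Ck_cst _ _ R^o k (chart_cod c) (-1)) (sg c ca k)).
  by congr (Ck _ _ _); apply/funext => u /=; rewrite mulN1r.
- exact: (CkM (sf c ca k) (sg c ca k)).
Qed.
HB.instance Definition _ :=
  GRing.isSubringClosed.Build (M -> R) smooth_function smooth_function_subring.

Fact smooth_function_scaler : scaler_closed smooth_function.
Proof.
move=> a f /asboolP sf; apply/asboolP => c ca k.
exact: (CkM (@Ck_cst _ _ R^o k (chart_cod c) a) (sf c ca k)).
Qed.
HB.instance Definition _ :=
  GRing.isScaleClosed.Build R (M -> R) smooth_function smooth_function_scaler.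

Record Cinfty := MkCinfty {
  Cinfty_fun :> M -> R;
  _ : Cinfty_fun \in smooth_function
}.
HB.instance Definition _ := [isSub for Cinfty_fun].
HB.instance Definition _ := [Choice of Cinfty by <:].
HB.instance Definition _ :=
  GRing.SubChoice_isSubComPzRing.Build _ _ Cinfty (subringClosedP _).
HB.instance Definition _ := [SubZmodule_isSubLmodule of Cinfty by <:].

Lemma CinftyP (f g : Cinfty) : (forall p, f p = g p) -> f = g.
Proof. by move=> fg; apply: val_inj; apply/funext. Qed.

Lemma CinftyZ (a : R) (f : Cinfty) p : (a *: f) p = a * f p.
Proof. by []. Qed.
Lemma CinftyM (f g : Cinfty) p : (f * g) p = f p * g p.
Proof. by []. Qed.
Lemma CinftyD (f g : Cinfty) p : (f + g) p = f p + g p.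
Proof. by []. Qed.
Lemma CinftyN (f : Cinfty) p : (- f) p = - f p.
Proof. by []. Qed.

End SmoothFunctions.

Notation "a %:C" := (a *: (1 : Cinfty _)) : ring_scope.

(* Vector fields are the derivations of the algebra of smooth functions; they
   form a module over that algebra. *)
Section VectorFields.
Context {R : realType} {n : nat} (M : smoothManifoldType R n).
Local Notation A := (Cinfty M).

Definition derivation : {pred A -> A^o} := fun X =>
  `[< (forall (a : R) (f g : A), X (a *: f + g) = a *: (X f : A) + X g) /\
      (forall f g : A, X (f * g) = (X f : A) * g + f * (X g : A)) >].

Fact derivation_submod : submod_closed derivation.
Proof.
split=> [|h X Y /asboolP[linX leibX] /asboolP[linY leibY]]; apply/asboolP.
  split=> [a f g|f g]; first by rewrite scaler0 addr0.
  by rewrite mul0r mulr0 addr0.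
have hXY u : (h *: X + Y) u = (h * (X u : A) + (Y u : A) : A) by [].
split=> [a f g|f g]; rewrite !hXY.
  rewrite linX linY; apply: CinftyP => p.
  by rewrite !(CinftyD, CinftyM, CinftyZ); ring.
by rewrite leibX leibY; ring.
Qed.
HB.instance Definition _ :=
  GRing.isSubmodClosed.Build A (A -> A^o) derivation derivation_submod.

Record vector_field := MkVectorField {
  vf_fun : A -> A^o;
  _ : vf_fun \in derivation
}.
HB.instance Definition _ := [isSub for vf_fun].
HB.instance Definition _ := [Choice of vector_field by <:].
HB.instance Definition _ := [SubChoice_isSubLmodule of vector_field by <:].

Definition vf_app (X : vector_field) (f : A) : A := vf_fun X f.
Coercion vf_app : vector_field >-> Funclass.

Lemma vfP (X Y : vector_field) : (forall f, X f = Y f) -> X = Y.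
Proof. by move=> XY; apply: val_inj; apply/funext. Qed.

Lemma vf_linear (X : vector_field) (a : R) (f g : A) :
  X (a *: f + g) = a *: X f + X g.
Proof. by case: X => X /= /asboolP[]. Qed.

Lemma vf_leibniz (X : vector_field) (f g : A) : X (f * g) = X f * g + f * X g.
Proof. by case: X => X /= /asboolP[]. Qed.

Definition bracket_fun (X Y : vector_field) : A -> A^o :=
  fun f => X (Y f) - Y (X f).

Fact bracket_derivation X Y : bracket_fun X Y \in derivation.
Proof.
have vfD (Z : vector_field) u v : Z (u + v) = Z u + Z v.
  by have := vf_linear Z 1 u v; rewrite !scale1r.
rewrite /bracket_fun; apply/asboolP; split=> [a f g|f g].
  rewrite !vf_linear; apply: CinftyP => p.
  by rewrite !(CinftyD, CinftyN, CinftyZ); ring.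
by rewrite !vf_leibniz !vfD !vf_leibniz; ring.
Qed.

Definition lie_bracket (X Y : vector_field) : vector_field :=
  MkVectorField (bracket_derivation X Y).

Record riemannian_metric (g : vector_field -> vector_field -> A) : Prop := {
  metric_linear : forall (h : A) (X Y Z : vector_field),
    g (h *: X + Y) Z = h * g X Z + g Y Z;
  metric_sym : forall X Y : vector_field, g X Y = g Y X;
  (* positive definiteness on each tangent space: the value of X at p is the
     functional f |-> X f p *)
  metric_pos : forall (X : vector_field) (p : M),
    (exists f, X f p != 0) -> 0 < g X X p
}.

Record levi_civita (g : vector_field -> vector_field -> A)
    (nabla : vector_field -> vector_field -> vector_field) : Prop := {
  nabla_linear : forall (h : A) (X Y Z : vector_field),
    nabla (h *: X + Y) Z = h *: nabla X Z + nabla Y Z;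
  nablaD : forall X Y Z : vector_field,
    nabla X (Y + Z) = nabla X Y + nabla X Z;
  nabla_leibniz : forall (h : A) (X Y : vector_field),
    nabla X (h *: Y) = X h *: Y + h *: nabla X Y;
  nabla_torsion_free : forall X Y : vector_field,
    nabla X Y - nabla Y X = lie_bracket X Y;
  nabla_metric : forall X Y Z : vector_field,
    X (g Y Z) = g (nabla X Y) Z + g Y (nabla X Z)
}.

(* (nabla_X phi) Y = nabla_X (phi Y) - phi (nabla_X Y) *)
Definition fundamental_tensor (phi : vector_field -> vector_field)
    (g : vector_field -> vector_field -> A)
    (nabla : vector_field -> vector_field -> vector_field)
    (X Y Z : vector_field) : A :=
  g (nabla X (phi Y) - phi (nabla X Y)) Z.

End VectorFields.

Section LeftInvariance.
Context {R : realType} {n : nat} (L : lieGroupType R n).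
Local Notation A := (Cinfty L).
Local Notation vf := (vector_field L).

(* Y = (L_a)_* X for the left translation L_a : p |-> a * p, that is
   X (f \o L_a) = (Y f) \o L_a for every smooth f; h stands for f \o L_a. *)
Definition left_translated (a : L) (X Y : vf) : Prop :=
  forall f h : A, (forall p, h p = f (a * p)%g) ->
    forall p, X h p = Y f (a * p)%g.

Definition left_invariant (X : vf) : Prop := forall a, left_translated a X X.

(* basis over R of the left-invariant fields, not over the ring A *)
Definition left_invariant_basis (E : 'I_n -> vf) : Prop :=
  (forall i, left_invariant (E i)) /\
  (forall X, left_invariant X ->
     exists! c : 'rV[R]_n, X = \sum_i (c 0 i)%:C *: E i).

Definition left_invariant_endo (phi : vf -> vf) : Prop :=
  forall a X X', left_translated a X X' -> left_translated a (phi X) (phi X').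

Definition left_invariant_form (eta : vf -> A) : Prop :=
  forall a X X', left_translated a X X' ->
    forall p, eta X p = eta X' (a * p)%g.

Definition left_invariant_form2 (g : vf -> vf -> A) : Prop :=
  forall a X X' Y Y', left_translated a X X' -> left_translated a Y Y' ->
    forall p, g X Y p = g X' Y' (a * p)%g.

End LeftInvariance.

Section Dimension3.
Context {R : realType} (L : lieGroupType R 3).
Local Notation A := (Cinfty L).
Local Notation vf := (vector_field L).

Definition i0 : 'I_3 := Ordinal (isT : (0 < 3)%N).
Definition i1 : 'I_3 := Ordinal (isT : (1 < 3)%N).
Definition i2 : 'I_3 := Ordinal (isT : (2 < 3)%N).

(* Left-invariant almost paracontact almost paracomplex Riemannian structure. *)
Record apapR_structure (E : 'I_3 -> vf)
    (phi : vf -> vf) (xi : vf) (eta : vf -> A) (g : vf -> vf -> A) : Prop := {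
  phi_linear : forall (h : A) (X Y : vf),
    phi (h *: X + Y) = h *: phi X + phi Y;
  phi_left_invariant : left_invariant_endo phi;
  phi0 : phi (E i0) = 0;
  phi1 : phi (E i1) = E i2;
  phi2 : phi (E i2) = E i1;
  xi_def : xi = E i0;
  eta_linear : forall (h : A) (X Y : vf),
    eta (h *: X + Y) = h * eta X + eta Y;
  eta_left_invariant : left_invariant_form eta;
  eta0 : eta (E i0) = 1;
  eta1 : eta (E i1) = 0;
  eta2 : eta (E i2) = 0;
  g_metric : riemannian_metric g;
  g_left_invariant : left_invariant_form2 g;
  g_orthonormal : forall i j : 'I_3, g (E i) (E j) = (i == j)%:R
}.

Inductive basic_class := F1 | F4 | F5 | F8 | F9 | F10 | F11.

(* theta0s is the coefficient written theta_0 with a star *)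
Record coefficients := Coefficients {
  theta0 : R; theta1 : R; theta2 : R; theta0s : R;
  lambda : R; mu : R; nu : R; omega1 : R; omega2 : R
}.

Definition class_tensor (s : basic_class) (c : coefficients)
    (x y z : 'I_3 -> A) : A :=
  let x0 := x i0 in let x1 := x i1 in let x2 := x i2 in
  let y0 := y i0 in let y1 := y i1 in let y2 := y i2 in
  let z0 := z i0 in let z1 := z i1 in let z2 := z i2 in
  match s with
  | F1 => (theta1 c *: x1 - theta2 c *: x2) * (y1 * z1 - y2 * z2)
  | F4 => (theta0 c / 2) *:
      (x1 * (y0 * z1 + y1 * z0) + x2 * (y0 * z2 + y2 * z0))
  | F5 => (theta0s c / 2) *:
      (x1 * (y0 * z2 + y2 * z0) + x2 * (y0 * z1 + y1 * z0))
  | F8 => lambda c *: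
      (x1 * (y0 * z1 + y1 * z0) - x2 * (y0 * z2 + y2 * z0))
  | F9 => mu c *:
      (x1 * (y0 * z2 + y2 * z0) - x2 * (y0 * z1 + y1 * z0))
  | F10 => nu c *: (x0 * (y1 * z1 - y2 * z2))
  | F11 => x0 * (omega1 c *: (y0 * z1 + y1 * z0)
                 + omega2 c *: (y0 * z2 + y2 * z0))
  end.

(* The definition of the coefficients relevant to the class s in terms of the
   components F i j k of the tensor; the other fields are unconstrained. *)
Definition class_coefficients (s : basic_class) (c : coefficients)
    (F : 'I_3 -> 'I_3 -> 'I_3 -> A) : Prop :=
  match s with
  | F1 => [/\ (theta1 c)%:C = F i1 i1 i1, (theta1 c)%:C = - F i1 i2 i2,
              (theta2 c)%:C = F i2 i2 i2 & (theta2 c)%:C = - F i2 i1 i1]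
  | F4 => (theta0 c)%:C = F i1 i1 i0 + F i2 i2 i0
  | F5 => (theta0s c)%:C = F i1 i2 i0 + F i2 i1 i0
  | F8 => (lambda c)%:C = F i1 i1 i0 /\ (lambda c)%:C = - F i2 i2 i0
  | F9 => (mu c)%:C = F i1 i2 i0 /\ (mu c)%:C = - F i2 i1 i0
  | F10 => (nu c)%:C = F i0 i1 i1 /\ (nu c)%:C = - F i0 i2 i2
  | F11 => (omega1 c)%:C = F i0 i0 i1 /\ (omega2 c)%:C = F i0 i0 i2
  end.

Definition belongs_to (E : 'I_3 -> vf) (F : vf -> vf -> vf -> A)
    (s : basic_class) (c : coefficients) : Prop :=
  class_coefficients s c (fun i j k => F (E i) (E j) (E k)) /\
  forall x y z : 'I_3 -> A,
    F (\sum_i x i *: E i) (\sum_i y i *: E i) (\sum_i z i *: E i) =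
    class_tensor s c x y z.

(* beta is ignored outside F1 and F11 *)
Definition commutators (E : 'I_3 -> vf) (s : basic_class) (alpha beta : R)
    : Prop :=
  let E0 := E i0 in let E1 := E i1 in let E2 := E i2 in
  match s with
  | F1 => [/\ lie_bracket E0 E1 = 0, lie_bracket E0 E2 = 0 &
              lie_bracket E1 E2 = alpha%:C *: E1 - beta%:C *: E2]
  | F4 => [/\ lie_bracket E0 E1 = alpha%:C *: E2,
              lie_bracket E0 E2 = alpha%:C *: E1 & lie_bracket E1 E2 = 0]
  | F5 => [/\ lie_bracket E0 E1 = alpha%:C *: E1,
              lie_bracket E0 E2 = alpha%:C *: E2 & lie_bracket E1 E2 = 0]
  | F8 => [/\ lie_bracket E0 E1 = alpha%:C *: E2,
              lie_bracket E0 E2 = - (alpha%:C *: E1) &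
              lie_bracket E1 E2 = (2 * alpha)%:C *: E0]
  | F9 => [/\ lie_bracket E0 E1 = alpha%:C *: E1,
              lie_bracket E0 E2 = - (alpha%:C *: E2) & lie_bracket E1 E2 = 0]
  | F10 => [/\ lie_bracket E0 E1 = - (alpha%:C *: E2),
              lie_bracket E0 E2 = alpha%:C *: E1 & lie_bracket E1 E2 = 0]
  | F11 => [/\ lie_bracket E0 E1 = alpha%:C *: E0,
              lie_bracket E0 E2 = beta%:C *: E0 & lie_bracket E1 E2 = 0]
  end.

Definition parameters (s : basic_class) (c : coefficients) (alpha beta : R)
    : Prop :=
  match s with
  | F1 => alpha = theta1 c / 2 /\ beta = theta2 c / 2
  | F4 => alpha = theta0 c / 2
  | F5 => alpha = theta0s c / 2
  | F8 => alpha = lambda c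
  | F9 => alpha = mu c
  | F10 => alpha = nu c / 2
  | F11 => alpha = omega2 c /\ beta = omega1 c
  end.

End Dimension3.

(* Main.v *)
(* The connection is natural under left translations: by the Koszul formula,
   a translation transports g (nabla_X Y, Z) for every field Z; every field is
   the translate of some Z and g is nondegenerate, so the translation also
   transports nabla_X Y.  Hence nabla_{E_i} E_j is left-invariant, a
   combination of the E_k with real coefficients, which are skew in (j, k)
   since g is constant on the basis.  Nine real numbers remain.  The
   commutators (through the vanishing torsion) and F are both injective linear
   functions of these nine numbers, so that each of the two conditions of the
   theorem amounts to prescribing them, and the prescribed values agree. *)

Require Import Defs.
From HB Require Import structures.
From mathcomp Require Import all_boot all_order all_algebra.
From mathcomp Require Import all_classical all_reals all_analysis.
From mathcomp Require Import ring lra.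

Set Implicit Arguments.
Unset Strict Implicit.
Unset Printing Implicit Defensive.

Import Order.TTheory GRing.Theory Num.Theory.
Import numFieldNormedType.Exports.

Local Open Scope classical_set_scope.
Local Open Scope ring_scope.

(** * Calculus of C^k maps: locality, composition, slices of products *)

Lemma near_eq_is_diff (R : realType) (V W : normedModType R) (f g df : V -> W)
    (x : V) :
  (\forall y \near x, f y = g y) -> is_diff x f df -> is_diff x g df.
Proof.
move=> fg [fx <-].
have [dfc fE] := (diff_locallyP x f).1 fx.
(* The first-order expansion of [f] at [x] involves only values near [x], so it is one of [g] too;
   uniqueness of the differential does the rest. *)
have gE : g \o shift x = cst (g x) + 'd f x +o_ 0 id.
  apply/eqaddoP => e e0; have /eqaddoP/(_ e e0) := fE.
  have fg0 : \forall h \near 0, f (h + x) = g (h + x).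
    by rewrite (near_shift x 0) sub0r; near=> y; rewrite /= subrK; near: y.
  apply: filterS2 fg0 => h /= fgh; rewrite !fctE /= fgh.
  by rewrite (nbhs_singleton fg).
have dg : 'd g x = 'd f x :> (V -> W).
  exact: diff_unique gE.
apply: DiffDef; last exact: dg.
apply/diff_locallyP; rewrite dg; split; last exact: gE.
exact: dfc.
Unshelve. all: by end_near. Qed.

Section CkTheory.
Context {R : realType}.
Implicit Types V W : normedModType R.

(** On an open set the two functions agree near each point, so the same derivative [df] serves both
    and a case split on [k] replaces induction. *)
Lemma Ck_eq V W k (A : set V) (f g : V -> W) : open A ->
  (forall x, A x -> f x = g x) -> Ck k A f -> Ck k A g.
Proof.
move=> oA; case: k => [|k] fg.
  move=> cf x Ax; have fxg : \forall y \near x, f y = g y.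
    by apply: filterS fg _; exact: open_nbhs_nbhs.
  rewrite /prop_for /continuous_at -(fg x Ax).
  by apply: cvg_trans (cf x Ax); exact: near_eq_cvg.
move=> [df [fdf dfk]]; exists df; split=> // x Ax.
apply: near_eq_is_diff (fdf x Ax).
by apply: filterS fg _; exact: open_nbhs_nbhs.
Qed.

(** The derivatives given on the sets [B] vary with the point; the canonical differential ['d f x]
    agrees with each of them and so glues them. *)
Lemma Ck_locally V W k (A : set V) (f : V -> W) :
  (forall x, A x -> exists B, [/\ open B, B x & Ck k B f]) -> Ck k A f.
Proof.
elim: k f => [|k IH] f locf; first by move=> x /locf[B [_ Bx]]; exact.
exists (fun x v => 'd f x v); split=> [x Ax|v].
  have [B [_ Bx [df [/(_ x Bx) [? _] _]]]] := locf x Ax.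
  exact: differentiableP.
apply: IH => x Ax; have [B [oB Bx [df [fdf dfk]]]] := locf x Ax.
exists B; split=> //; apply: Ck_eq (dfk v) => // y By.
by case: (fdf y By) => _ ->.
Qed.

Lemma Ck_comp_coord V k m (A : set V) (h : V -> 'rV[R]_m) i :
  Ck k A h -> Ck k A ((fun x => h x 0 i) : V -> R^o).
Proof.
elim: k h => [|k IH] h /=.
  by move=> ch x Ax; apply: (@continuous_comp _ _ _ h (fun N : 'rV_m => N 0 i));
    [exact: ch | exact: coord_continuous].
move=> [dh [hdh dhk]].
exists (fun x v => dh x v 0 i); split=> [x Ax|v]; last exact: IH.
have hx := hdh x Ax.
have lin_coord : linear (fun N : 'rV[R]_m => N 0 i : R^o).
  by move=> a u v; rewrite !mxE.
pose cl : {linear 'rV[R]_m -> R^o} :=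
  HB.pack (fun N : 'rV[R]_m => N 0 i : R^o)
    (GRing.isLinear.Build _ _ _ _ _ lin_coord).
have clc : continuous cl by exact: coord_continuous.
have cld : is_diff (h x) cl cl.
  by apply: DiffDef; [exact: linear_differentiable | exact: diff_lin].
exact: (is_diff_comp hx cld).
Qed.

Lemma Ck_sum V W k (A : set V) m (F : 'I_m -> V -> W) :
  (forall i, Ck k A (F i)) -> Ck k A (fun x => \sum_i F i x).
Proof.
elim: m F => [|m IH] F FC.
  have -> : (fun x => \sum_(i < 0) F i x) = fun=> 0.
    by apply/funext => x; rewrite big_ord0.
  exact: Ck_cst.
have -> : (fun x => \sum_(i < m.+1) F i x) =
    (fun x => \sum_(i < m) F (widen_ord (leqnSn m) i) x) \+ F ord_max.
  by apply/funext => x /=; rewrite big_ord_recr.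
by apply: CkD; [exact: IH | exact: FC].
Qed.

Lemma Ck_comp V k m (A : set V) (B : set 'rV[R]_m) (h : V -> 'rV[R]_m)
    (f : 'rV[R]_m -> R^o) :
  (forall x, A x -> B (h x)) -> Ck k A h -> Ck k B f -> Ck k A (f \o h).
Proof.
move=> AB; elim: k f => [|k IH] f.
  by move=> ch cf x Ax; apply: continuous_comp; [exact: ch | exact/cf/AB].
move=> hk; have hk' := Ck_pred hk; case: hk => dh [hdh dhk] [df [fdf dfk]].
(* Expanding [dh x v] in coordinates writes the differential of the composite,
   applied to a fixed [v], as a sum of products of C^k functions. *)
pose F v i x : R^o := dh x v 0 i * df (h x) (delta_mx 0 i).
exists (fun x v => \sum_i F v i x); split=> [x Ax|v]; last first.
  apply: Ck_sum => i; apply: (CkM (f := fun x => dh x v 0 i)).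
    exact: (Ck_comp_coord i (dhk v)).
  exact: (IH (fun u => df u (delta_mx 0 i)) hk' (dfk _)).
have hx := hdh x Ax; have fhx := fdf (h x) (AB x Ax).
apply: (is_diff_eq (is_diff_comp hx fhx)); apply/funext => v /=.
rewrite /F; have [_ <-] := fhx; rewrite [in LHS](row_sum_delta (dh x v)).
by rewrite linear_sum; apply: eq_bigr => i _; exact: linearZ.
Qed.

(** Freezing the first factor turns joint smoothness of the multiplication into smoothness of a
    single left translation. *)
Lemma Ck_pair_const V V' W k (A : set V') (B : set (V * V')) (w : V)
    (f : V * V' -> W) :
  (forall x, A x -> B (w, x)) -> Ck k B f -> Ck k A (fun x => f (w, x)).
Proof.
move=> AB; elim: k f => [|k IH] f.
  move=> cf x Ax; apply: (@continuous_comp _ _ _ (pair w) f); last exact/cf/AB.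
  by apply: cvg_pair; [exact: cvg_cst | exact: cvg_id].
move=> [df [fdf dfk]].
exists (fun x v => df (w, x) (0, v)); split=> [x Ax|v]; last first.
  exact: (IH (fun u => df u (0, v)) (dfk _)).
have wx := is_diff_pair (is_diff_cst w x) (is_diff_id x).
exact: (is_diff_comp wx (fdf (w, x) (AB x Ax))).
Qed.

End CkTheory.

(** * Left translation of functions and vector fields *)

Section Translation.
Context {R : realType} {n : nat} (L : lieGroupType R n).
Local Notation A := (Cinfty L).
Local Notation vf := (vector_field L).

(** In charts, this is the expression of [f] composed with the multiplication whose first argument
    is frozen at [a]. *)
Lemma smooth_translate (a : L) (f : A) :
  (fun p => f (a * p)%g) \in @smooth_function R n L.
Proof.
case: f => f /= /asboolP sf; apply/asboolP => c ca k.
(* The target chart must contain the translated point, hence varies with it: smoothness is proved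
   locally. *)
apply: Ck_locally => u cu.
pose p := chart_inv c u.
have [d da dd] := @atlas_cover R n L a.
have [e ea de] := @atlas_cover R n L (a * p)%g.
pose B := [set v | chart_cod c v /\ chart_dom e (a * chart_inv c v)%g].
have mula : continuous (fun q : L => (a * q)%g).
  move=> q; apply: (@continuous_comp _ _ _ (pair a)
    (fun p : L * L => (p.1 * p.2)%g)).
    by apply: cvg_pair; [exact: cvg_cst | exact: cvg_id].
  exact: lie_mul_continuous.
have oB : open B.
  rewrite openE => v [cv ev]; rewrite /interior.
  apply: filterI.
    by apply: open_nbhs_nbhs; split=> //; exact: chart_cod_open.
  have : {for v, continuous (fun v => (a * chart_inv c v)%g)}.
    apply: (@continuous_comp _ _ _ (chart_inv c) (fun q => (a * q)%g)).
      exact: chart_inv_continuous.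
    exact: mula.
  by apply; apply/open_nbhs_nbhs; split=> //; exact: chart_dom_open.
exists B; split=> //.
pose h v := e (chart_inv d (d a) * chart_inv c v)%g.
have hk : Ck k B h.
  apply: (@Ck_pair_const _ _ _ _ k B _ (d a)
    (fun u => e (chart_inv d u.1 * chart_inv c u.2)%g)); last first.
    exact: (lie_mul_smooth d c e da ca ea).
  move=> v [cv ev]; split=> //=; first exact: chart_mapP.
  by rewrite chart_mapK.
have Bh v : B v -> chart_cod e (h v).
  by move=> [cv ev]; apply: chart_mapP; rewrite chart_mapK.
apply: (Ck_eq oB _ (Ck_comp Bh hk (sf e ea k))) => v [cv ev] /=.
by rewrite /h (chart_mapK dd) (chart_mapK ev).
Qed.

Definition translate (a : L) (f : A) : A := MkCinfty (smooth_translate a f).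

(** Conjugating a derivation by the algebra automorphism [translate a], with inverse
    [translate a^-1], gives a derivation: the pushforward of [X]. *)
Fact translate_field_derivation (a : L) (X : vf) :
  ((fun f => translate a^-1%g (X (translate a f))) : A -> A^o)
    \in @derivation R n L.
Proof.
have trD b (u v : A) : translate b (u + v) = translate b u + translate b v.
  exact: CinftyP.
have trM b (u v : A) : translate b (u * v) = translate b u * translate b v.
  exact: CinftyP.
have trZ b r (u : A) : translate b (r *: u) = r *: translate b u.
  exact: CinftyP.
apply/asboolP; split=> [r f h|f h].
  by rewrite !(trD, trZ) vf_linear !(trD, trZ).
by rewrite trM vf_leibniz trD !trM; congr (_ * _ + _ * _);
  apply: CinftyP => p /=; rewrite mulVKg.
Qed.

Definition translate_field (a : L) (X : vf) : vf :=
  MkVectorField (translate_field_derivation a X).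

Lemma left_translated_field (a : L) (X : vf) :
  left_translated a X (translate_field a X).
Proof.
move=> f h hE p; have -> : h = translate a f by exact: CinftyP.
by rewrite /vf_app /= mulKg.
Qed.

(** Exhibits any field as a translate, so that a test field can be prescribed on the target side. *)
Lemma left_translated_fieldV (a : L) (X : vf) :
  left_translated a (translate_field a^-1%g X) X.
Proof.
move=> f h hE p; rewrite /vf_app /= invgK; congr (vf_fun X _ _).
by apply: CinftyP => q /=; rewrite hE mulVKg.
Qed.

Lemma left_translated_bracket (a : L) (X X' Y Y' : vf) :
  left_translated a X X' -> left_translated a Y Y' ->
  left_translated a (lie_bracket X Y) (lie_bracket X' Y').
Proof.
move=> XX' YY' f h hE p.
have BE (U V : vf) (u : A) q :
  lie_bracket U V u q = U (V u) q - V (U u) q by [].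
rewrite !BE (XX' (Y' f)) => [|q]; last exact: YY'.
by rewrite (YY' (X' f)) => // q; exact: XX'.
Qed.

End Translation.

(** * Koszul formula and naturality of the Levi-Civita connection *)

Section LeviCivita.
Context {R : realType} {n : nat} (L : lieGroupType R n).
Local Notation A := (Cinfty L).
Local Notation vf := (vector_field L).
Variables (g : vf -> vf -> A) (nabla : vf -> vf -> vf).
Hypotheses (g_metric : riemannian_metric g) (nabla_g : levi_civita g nabla).

Lemma vf_const (X : vf) (r : R) : X r%:C = 0.
Proof.
have X1 : X 1 = 0.
  by apply: (addrI (X 1)); have := vf_leibniz X 1 1; rewrite !mul1r mulr1 addr0.
have X0 : X 0 = 0.
  by apply: (addrI (X 0)); have := vf_linear X 1 0 0; rewrite !scale1r !addr0.
by rewrite -[r%:C]addr0 vf_linear X1 X0 scaler0 addr0.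
Qed.

Lemma metricB (X Y Z : vf) : g (X - Y) Z = g X Z - g Y Z.
Proof.
have := metric_linear g_metric (-1) Y X Z.
by rewrite scaleN1r mulN1r addrC [in RHS]addrC.
Qed.

Lemma metric_nondegenerate (X : vf) : g X X = 0 -> X = 0.
Proof.
move=> gX; apply: vfP => f; apply: CinftyP => p.
have [//|Xfp] := eqVneq (X f p) ((0 : vf) f p).
have : 0 < g X X p by apply: (metric_pos g_metric); exists f.
by rewrite gX ltxx.
Qed.

(** Metric compatibility expands the three derivatives and vanishing torsion the three brackets;
    only two equal terms survive. The right side involves [g] and brackets alone, which can be
    transported. *)
Lemma koszul (X Y Z : vf) :
  g (nabla X Y) Z *+ 2 =
  X (g Y Z) + Y (g X Z) - Z (g X Y) + g (lie_bracket X Y) Z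
  - g (lie_bracket X Z) Y - g (lie_bracket Y Z) X.
Proof.
rewrite !(nabla_metric nabla_g) -!(nabla_torsion_free nabla_g) !metricB.
rewrite ![g X (nabla _ _)](Defs.metric_sym g_metric).
by rewrite ![g Y (nabla _ _)](Defs.metric_sym g_metric); ring.
Qed.

Hypothesis g_left_invariant : left_invariant_form2 g.

Lemma metric_nabla_left_translated (a : L) (X X' Y Y' Z Z' : vf) :
  left_translated a X X' -> left_translated a Y Y' -> left_translated a Z Z' ->
  forall p, g (nabla X Y) Z p = g (nabla X' Y') Z' (a * p)%g.
Proof.
move=> XX' YY' ZZ' p.
have gE U U' V V' : left_translated a U U' -> left_translated a V V' ->
    forall q, g U V q = g U' V' (a * q)%g.
  by move=> UU'; exact: g_left_invariant.
suff : (g (nabla X Y) Z *+ 2) p = (g (nabla X' Y') Z' *+ 2) (a * p)%g.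
  by rewrite !mulr2n !CinftyD; lra.
rewrite !koszul !(CinftyD, CinftyN).
rewrite (XX' _ _ (gE _ _ _ _ YY' ZZ')) (YY' _ _ (gE _ _ _ _ XX' ZZ')).
rewrite (ZZ' _ _ (gE _ _ _ _ XX' YY')).
rewrite (gE _ _ _ _ (left_translated_bracket XX' YY') ZZ').
rewrite (gE _ _ _ _ (left_translated_bracket XX' ZZ') YY').
by rewrite (gE _ _ _ _ (left_translated_bracket YY' ZZ') XX').
Qed.

Lemma left_translated_nabla (a : L) (X X' Y Y' : vf) :
  left_translated a X X' -> left_translated a Y Y' ->
  left_translated a (nabla X Y) (nabla X' Y').
Proof.
move=> XX' YY'; have NW := @left_translated_field _ _ _ a (nabla X Y).
suff <- : translate_field a (nabla X Y) = nabla X' Y' by [].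
move: (translate_field a _) NW => W NW.
apply/eqP; rewrite -subr_eq0; apply/eqP/metric_nondegenerate.
(* The difference, as second argument, is generalized to any field [Z'], which is then pulled back
   to the source side. *)
rewrite metricB; move: (W - _) => Z'; apply: CinftyP => p.
have ZZ' := @left_translated_fieldV _ _ _ a Z'.
have := metric_nabla_left_translated XX' YY' ZZ' (a^-1 * p)%g.
rewrite (g_left_invariant NW ZZ') mulVKg CinftyD CinftyN => ->.
exact: subrr.
Qed.

End LeviCivita.

(** * Connection matrices and the tensors of the seven classes *)

Lemma sum_ord3 (V : zmodType) (f : 'I_3 -> V) :
  \sum_i f i = f i0 + f i1 + f i2.
Proof.
rewrite !big_ord_recl big_ord0 addr0 addrA.
by congr (f _ + f _ + f _); exact: val_inj.
Qed.

(* The triple [k i = (a, b, c)] encodes the skew connection matrix in the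
   direction E_i: nabla_{E_i} E_0 = a E_1 + b E_2,
   nabla_{E_i} E_1 = - a E_0 + c E_2, nabla_{E_i} E_2 = - b E_0 - c E_1. *)
Definition connection_tensor (R : realType) (k : 'I_3 -> R * R * R)
    (x y z : 'I_3 -> R) : R :=
  \sum_i x i * (- (k i).1.1 * (y i0 * z i2 + y i2 * z i0)
               - (k i).1.2 * (y i0 * z i1 + y i1 * z i0)
               - 2 * (k i).2 * (y i1 * z i1 - y i2 * z i2)).

(** Evaluation at (E_i, E_0, E_1), (E_i, E_0, E_2) and (E_i, E_1, E_1) gives -b, -a and -2c. *)
Lemma connection_tensor_inj (R : realType) (k k' : 'I_3 -> R * R * R) :
  (forall x y z, connection_tensor k x y z = connection_tensor k' x y z) ->
  forall i, k i = k' i.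
Proof.
move=> kk' i; pose e (j l : 'I_3) : R := (l == j)%:R.
have sumE (f : 'I_3 -> R) : \sum_l e i l * f l = f i.
  rewrite (bigD1 i) //= big1 /e ?eqxx ?mul1r ?addr0 // => l /negPf ->.
  exact: mul0r.
have := (kk' (e i) (e i0) (e i1), kk' (e i) (e i0) (e i2),
         kk' (e i) (e i1) (e i1)).
rewrite /connection_tensor !sumE /e /=.
case: (k i) (k' i) => [[a b] c] [[a' b'] c'] /=.
by move=> [[? ?] ?]; congr (_, _, _); lra.
Qed.

(** The triples obtained by solving the commutators of each class for the connection, one entry per
    direction E_i; the default of [nth] is never reached. *)
Definition class_connection (R : realType) (s : basic_class) (alpha beta : R)
    (i : 'I_3) : R * R * R :=
  nth (0, 0, 0) match s with
  | F1 => [:: (0, 0, 0); (0, 0, - alpha); (0, 0, beta)]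
  | F4 => [:: (0, 0, 0); (0, - alpha, 0); (- alpha, 0, 0)]
  | F5 => [:: (0, 0, 0); (- alpha, 0, 0); (0, - alpha, 0)]
  | F8 => [:: (0, 0, 0); (0, - alpha, 0); (alpha, 0, 0)]
  | F9 => [:: (0, 0, 0); (- alpha, 0, 0); (0, alpha, 0)]
  | F10 => [:: (0, 0, - alpha); (0, 0, 0); (0, 0, 0)]
  | F11 => [:: (- alpha, - beta, 0); (0, 0, 0); (0, 0, 0)]
  end i.

Lemma class_tensorE (R : realType) (L : lieGroupType R 3) (s : basic_class)
    (c : coefficients) (alpha beta : R) (x y z : 'I_3 -> Cinfty L) (p : L) :
  parameters s c alpha beta ->
  class_tensor s c x y z p =
  connection_tensor (class_connection s alpha beta)
    (fun i => x i p) (fun i => y i p) (fun i => z i p).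
Proof.
rewrite /connection_tensor sum_ord3 /class_connection /class_tensor.
case: s; rewrite !(CinftyD, CinftyN, CinftyM, CinftyZ) /=.
all: try by move=> ->; field.
all: by move=> [-> ->]; field.
Qed.

(** Uniqueness of the parameters: each one that [parameters] constrains in class [s] occurs, up to
    sign, as an entry of the triples. *)
Lemma parameters_class_connection (R : realType) (s : basic_class)
    (c : coefficients) (alpha beta alpha' beta' : R) :
  (forall i,
     class_connection s alpha beta i = class_connection s alpha' beta' i) ->
  parameters s c alpha beta -> parameters s c alpha' beta'.
Proof.
move=> k.
have ka i := congr1 (fun t => t.1.1) (k i).
have kb i := congr1 (fun t => t.1.2) (k i).
have kc i := congr1 (fun t => t.2) (k i).
have := ((ka i0, ka i1, ka i2), (kb i0, kb i1, kb i2), (kc i0, kc i1, kc i2)).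
rewrite /class_connection /parameters.
case: s {k ka kb kc} => /= -[[[[? ?] ?] [[? ?] ?]] [[? ?] ?]].
all: try lra.
all: by move=> [? ?]; split; lra.
Qed.

(** * Connection and brackets in the orthonormal frame *)

Section Connection.
Context {R : realType} (L : lieGroupType R 3).
Local Notation A := (Cinfty L).
Local Notation vf := (vector_field L).
Variables (E : 'I_3 -> vf) (phi : vf -> vf) (xi : vf) (eta : vf -> A).
Variables (g : vf -> vf -> A) (nabla : vf -> vf -> vf).
Hypothesis E_basis : left_invariant_basis E.
Hypothesis structure : apapR_structure E phi xi eta g.
Hypothesis nabla_g : levi_civita g nabla.

Local Notation E0 := (E i0).
Local Notation E1 := (E i1).
Local Notation E2 := (E i2).

(** Real coefficients turn equations between left-invariant fields into equations between triples of
    numbers. *)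
Definition frame (x y z : R) : vf := x%:C *: E0 + y%:C *: E1 + z%:C *: E2.

Lemma sum_frame (x : 'I_3 -> A) :
  \sum_i x i *: E i = x i0 *: E0 + x i1 *: E1 + x i2 *: E2.
Proof. exact: sum_ord3. Qed.

Lemma constE (r : R) (p : L) : (r%:C : A) p = r.
Proof. exact: mulr1. Qed.

Lemma metricDl (X Y Z : vf) : g (X + Y) Z = g X Z + g Y Z.
Proof.
by have := metric_linear (g_metric structure) 1 X Y Z; rewrite scale1r mul1r.
Qed.

Lemma metric0l (Z : vf) : g 0 Z = 0.
Proof. by apply: (addrI (g 0 Z)); rewrite -metricDl !addr0. Qed.

Lemma metricZl (h : A) (X Z : vf) : g (h *: X) Z = h * g X Z.
Proof.
by have := metric_linear (g_metric structure) h X 0 Z; rewrite metric0l !addr0.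
Qed.

Lemma metric_frame (x y z : R) (p : L) :
  [/\ g (frame x y z) E0 p = x, g (frame x y z) E1 p = y
    & g (frame x y z) E2 p = z].
Proof.
split; rewrite !metricDl !metricZl !(g_orthonormal structure).
all: rewrite !(CinftyD, CinftyM) !constE.
all: by rewrite !(mulr0, mulr1, addr0, add0r).
Qed.

Lemma frame_inj (x y z x' y' z' : R) :
  frame x y z = frame x' y' z' -> [/\ x = x', y = y' & z = z'].
Proof.
move=> xx'; have := metric_frame x y z 1%g; rewrite {}xx'.
have [-> -> ->] := metric_frame x' y' z' 1%g.
by case=> -> -> ->.
Qed.

Lemma frame0 : frame 0 0 0 = 0.
Proof. by rewrite /frame !scale0r !addr0. Qed.

Lemma frameE0 (x : R) : x%:C *: E0 = frame x 0 0.
Proof. by rewrite /frame !scale0r !addr0. Qed.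

Lemma frameE1 (y : R) : y%:C *: E1 = frame 0 y 0.
Proof. by rewrite /frame !scale0r !addr0 add0r. Qed.

Lemma frameE2 (z : R) : z%:C *: E2 = frame 0 0 z.
Proof. by rewrite /frame !scale0r !add0r. Qed.

Lemma frameN (x y z : R) : - frame x y z = frame (- x) (- y) (- z).
Proof. by rewrite /frame !opprD !scaleNr. Qed.

Lemma frameD (x y z x' y' z' : R) :
  frame x y z + frame x' y' z' = frame (x + x') (y + y') (z + z').
Proof.
have sumE (u u' v v' w w' : vf) :
    u + v + w + (u' + v' + w') = u + u' + (v + v') + (w + w').
  by rewrite addrACA [u + v + _]addrACA.
rewrite /frame sumE.
by congr (_ + _ + _); rewrite -scalerDl -[_%:C + _]scalerDl.
Qed.

Lemma left_invariant_frame (X : vf) : left_invariant X ->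
  X = frame (g X E0 1%g) (g X E1 1%g) (g X E2 1%g).
Proof.
move=> /E_basis.2[c [-> _]]; rewrite (sum_frame (fun i => (c 0 i)%:C)).
rewrite -/(frame _ _ _).
by have [-> -> ->] := metric_frame (c 0 i0) (c 0 i1) (c 0 i2) 1%g.
Qed.

Lemma left_invariant_nabla (i j : 'I_3) : left_invariant (nabla (E i) (E j)).
Proof.
move=> a; apply: (left_translated_nabla (g_metric structure) nabla_g).
- exact: g_left_invariant structure.
- exact: E_basis.1.
- exact: E_basis.1.
Qed.

(** The function [g (E j) (E k)] is constant, so its derivative along [E i], expanded by metric
    compatibility, is zero. *)
Lemma metric_nabla_skew (i j k : 'I_3) (p : L) :
  g (nabla (E i) (E j)) (E k) p = - g (nabla (E i) (E k)) (E j) p.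
Proof.
apply/eqP; rewrite -addr_eq0 -CinftyD.
rewrite [X in _ + X](Defs.metric_sym (g_metric structure)).
rewrite -(nabla_metric nabla_g) (g_orthonormal structure) -scaler_nat.
by rewrite (vf_const (E i)).
Qed.

(** By left invariance the coefficients of [nabla (E i) (E j)] are constant, so their values at the
    identity suffice. *)
Definition conn_a i := g (nabla (E i) E0) E1 1%g.
Definition conn_b i := g (nabla (E i) E0) E2 1%g.
Definition conn_c i := g (nabla (E i) E1) E2 1%g.

Definition connection i := (conn_a i, conn_b i, conn_c i).

Lemma metric_nabla_diag (i j : 'I_3) (p : L) :
  g (nabla (E i) (E j)) (E j) p = 0.
Proof. by have := metric_nabla_skew i j j p; lra. Qed.

Lemma nabla0 i : nabla (E i) E0 = frame 0 (conn_a i) (conn_b i).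
Proof.
rewrite [LHS](left_invariant_frame (left_invariant_nabla _ _)).
by rewrite metric_nabla_diag.
Qed.

Lemma nabla1 i : nabla (E i) E1 = frame (- conn_a i) 0 (conn_c i).
Proof.
rewrite [LHS](left_invariant_frame (left_invariant_nabla _ _)).
by rewrite metric_nabla_diag [X in frame X](metric_nabla_skew _ i1 i0).
Qed.

Lemma nabla2 i : nabla (E i) E2 = frame (- conn_b i) (- conn_c i) 0.
Proof.
rewrite [LHS](left_invariant_frame (left_invariant_nabla _ _)).
rewrite metric_nabla_diag [X in frame X](metric_nabla_skew _ i2 i0).
by rewrite [X in frame _ X](metric_nabla_skew _ i2 i1).
Qed.

Lemma bracket01 : lie_bracket E0 E1 =
  frame (- conn_a i0) (- conn_a i1) (conn_c i0 - conn_b i1).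
Proof.
rewrite -(nabla_torsion_free nabla_g) nabla1 nabla0 frameN frameD.
by rewrite oppr0 addr0 add0r.
Qed.

Lemma bracket02 : lie_bracket E0 E2 =
  frame (- conn_b i0) (- conn_c i0 - conn_a i2) (- conn_b i2).
Proof.
rewrite -(nabla_torsion_free nabla_g) nabla2 nabla0 frameN frameD.
by rewrite oppr0 addr0 add0r.
Qed.

Lemma bracket12 : lie_bracket E1 E2 =
  frame (conn_a i2 - conn_b i1) (- conn_c i1) (- conn_c i2).
Proof.
rewrite -(nabla_torsion_free nabla_g) nabla2 nabla1 frameN frameD.
by rewrite opprK oppr0 addr0 add0r addrC.
Qed.

(** Six of the nine bracket coefficients are single connection coefficients up to sign. The other
    three are c_0 - b_1, - c_0 - a_2 and a_2 - b_1, which determine c_0, b_1 and a_2, so [lra] works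
    in both directions. *)
Lemma commutatorsP (s : basic_class) (alpha beta : R) :
  commutators E s alpha beta <->
  forall i, connection i = class_connection s alpha beta i.
Proof.
have frame3 x y z x' y' z' : x = x' -> y = y' -> z = z' ->
  frame x y z = frame x' y' z' by move=> -> -> ->.
have -> : (forall i, connection i = class_connection s alpha beta i) <->
    [/\ connection i0 = class_connection s alpha beta i0,
        connection i1 = class_connection s alpha beta i1 &
        connection i2 = class_connection s alpha beta i2].
  split=> [k|[k0 k1 k2] [[|[|[|//]]] lti]]; first by split.
  - by rewrite (_ : Ordinal lti = i0) //; exact: val_inj.
  - by rewrite (_ : Ordinal lti = i1) //; exact: val_inj.
  - by rewrite (_ : Ordinal lti = i2) //; exact: val_inj.
rewrite /commutators /class_connection /connection.
rewrite bracket01 bracket02 bracket12 -frame0.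
case: s; rewrite /= ?(frameE0, frameE1, frameE2, frameN, frameD).
all: split; [move=> [/frame_inj[? ? ?] /frame_inj[? ? ?] /frame_inj[? ? ?]]
            |move=> [[? ? ?] [? ? ?] [? ? ?]]];
     [split; congr (_, _, _); lra|split; apply: frame3; lra].
Qed.

(** * The tensor F in the frame and membership in a class *)

Local Notation F := (fundamental_tensor phi g nabla).

Lemma phiD (X Y : vf) : phi (X + Y) = phi X + phi Y.
Proof. by have := phi_linear structure 1 X Y; rewrite !scale1r. Qed.

Lemma phi_0 : phi 0 = 0.
Proof. by apply: (addrI (phi 0)); rewrite -phiD !addr0. Qed.

Lemma phiZ (h : A) (X : vf) : phi (h *: X) = h *: phi X.
Proof. by have := phi_linear structure h X 0; rewrite phi_0 !addr0. Qed.

Lemma phi_frame (x y z : R) : phi (frame x y z) = frame 0 z y.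
Proof.
rewrite /frame !phiD !phiZ (phi0 structure) (phi1 structure) (phi2 structure).
by rewrite scaler0 scale0r scale0r !add0r addrC.
Qed.

Lemma fundamental_tensor_linear1 (h : A) (X Y Z W : vf) :
  F (h *: X + Y) Z W = h * F X Z W + F Y Z W.
Proof.
rewrite /fundamental_tensor !(nabla_linear nabla_g) (phi_linear structure).
by rewrite !(metricB (g_metric structure)) !(metricDl, metricZl); ring.
Qed.

(** Tensoriality: the Leibniz terms [X h *: phi Y] of the two summands cancel. *)
Lemma fundamental_tensor_linear2 (h : A) (X Y Z W : vf) :
  F X (h *: Y + Z) W = h * F X Y W + F X Z W.
Proof.
rewrite /fundamental_tensor (phi_linear structure) !(nablaD nabla_g).
rewrite !(nabla_leibniz nabla_g) !phiD !phiZ !(metricB (g_metric structure)).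
by rewrite !(metricDl, metricZl); ring.
Qed.

Lemma fundamental_tensor_linear3 (h : A) (X Y Z W : vf) :
  F X Y (h *: Z + W) = h * F X Y Z + F X Y W.
Proof.
rewrite /fundamental_tensor !(Defs.metric_sym (g_metric structure) (_ - _)).
exact: metric_linear (g_metric structure) _ _ _ _.
Qed.

Lemma linear_sum_frame (u : vf -> A) (x : 'I_3 -> A) :
  (forall (h : A) (X Y : vf), u (h *: X + Y) = h * u X + u Y) ->
  u (\sum_i x i *: E i) = x i0 * u E0 + x i1 * u E1 + x i2 * u E2.
Proof.
move=> ulin; rewrite sum_frame -addrA !ulin addrA; congr (_ + _).
have u0 : u 0 = 0.
  by apply: (addrI (u 0)); have := ulin 1 0 0; rewrite scale1r mul1r !addr0.
by have := ulin (x i2) E2 0; rewrite u0 !addr0.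
Qed.

(** The matrix is the commutator of the skew connection matrix with the symmetric matrix of [phi],
    hence symmetric in the last two slots. *)
Lemma fundamental_tensor_frame (i : 'I_3) (p : L) :
  [/\ [/\ F (E i) E0 E0 p = 0, F (E i) E0 E1 p = - conn_b i
        & F (E i) E0 E2 p = - conn_a i],
      [/\ F (E i) E1 E0 p = - conn_b i, F (E i) E1 E1 p = - (2 * conn_c i)
        & F (E i) E1 E2 p = 0]
    & [/\ F (E i) E2 E0 p = - conn_a i, F (E i) E2 E1 p = 0
        & F (E i) E2 E2 p = 2 * conn_c i]].
Proof.
have nabla_0 : nabla (E i) 0 = 0.
  by apply: (addrI (nabla (E i) 0)); rewrite -(nablaD nabla_g) !addr0.
rewrite /fundamental_tensor (phi0 structure) (phi1 structure) (phi2 structure).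
rewrite nabla_0 nabla0 nabla1 nabla2 !phi_frame -frame0 !frameN !frameD.
have f0 x y z : g (frame x y z) E0 p = x by case: (metric_frame x y z p).
have f1 x y z : g (frame x y z) E1 p = y by case: (metric_frame x y z p).
have f2 x y z : g (frame x y z) E2 p = z by case: (metric_frame x y z p).
by rewrite !f0 !f1 !f2; split; split; lra.
Qed.

Lemma fundamental_tensorE (x y z : 'I_3 -> A) (p : L) :
  F (\sum_i x i *: E i) (\sum_i y i *: E i) (\sum_i z i *: E i) p =
  connection_tensor connection
    (fun i => x i p) (fun i => y i p) (fun i => z i p).
Proof.
have FiE i : F (E i) (\sum_i y i *: E i) (\sum_i z i *: E i) p =
    - conn_a i * (y i0 p * z i2 p + y i2 p * z i0 p)
    - conn_b i * (y i0 p * z i1 p + y i1 p * z i0 p)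
    - 2 * conn_c i * (y i1 p * z i1 p - y i2 p * z i2 p).
  have [[e00 e01 e02] [e10 e11 e12] [e20 e21 e22]] :=
    fundamental_tensor_frame i p.
  have sum3 j : F (E i) (E j) (\sum_i z i *: E i) = z i0 * F (E i) (E j) E0 +
      z i1 * F (E i) (E j) E1 + z i2 * F (E i) (E j) E2.
    by apply: linear_sum_frame => h X Y; exact: fundamental_tensor_linear3.
  rewrite (@linear_sum_frame (fun Y => F (E i) Y _)) ?sum3; last first.
    by move=> h X Y; exact: fundamental_tensor_linear2.
  rewrite !(CinftyD, CinftyM) e00 e01 e02 e10 e11 e12 e20 e21 e22.
  by ring.
rewrite (@linear_sum_frame (fun X => F X _ _)); last first.
  by move=> h X Y; exact: fundamental_tensor_linear1.
by rewrite !(CinftyD, CinftyM) !FiE /connection_tensor sum_ord3.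
Qed.

Lemma belongs_toP (s : basic_class) (c : coefficients) :
  belongs_to E F s c <->
  exists alpha beta, parameters s c alpha beta /\
    forall i, connection i = class_connection s alpha beta i.
Proof.
split=> [[_ Fc]|[al [be [par conn]]]].
  pose al := match s with
    | F1 => theta1 c / 2 | F4 => theta0 c / 2 | F5 => theta0s c / 2
    | F8 => lambda c | F9 => mu c | F10 => nu c / 2 | F11 => omega2 c end.
  (* The value [theta2 c / 2] is meant for [F1]; outside [F1] and [F11] any real would do. *)
  pose be := match s with F11 => omega1 c | _ => theta2 c / 2 end.
  have par : parameters s c al be by rewrite /al /be; case: (s).
  exists al, be; split=> //; apply: connection_tensor_inj => x y z.
  (* Constant component functions, evaluated at the identity, reduce the identity over smooth
     functions to one over the reals. *)
  have := congr1 (fun f : A => f 1%g)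
    (Fc (fun i => (x i)%:C) (fun i => (y i)%:C) (fun i => (z i)%:C)).
  rewrite fundamental_tensorE (class_tensorE _ _ _ _ par) /connection_tensor.
  by rewrite !sum_ord3 !constE.
split=> [|x y z]; last first.
  apply: CinftyP => p; rewrite fundamental_tensorE (class_tensorE _ _ _ _ par).
  by rewrite /connection_tensor !sum_ord3 !conn.
have Fi01 i p : F (E i) E0 E1 p = - (connection i).1.2.
  by have [[_ -> _] _ _] := fundamental_tensor_frame i p.
have Fi02 i p : F (E i) E0 E2 p = - (connection i).1.1.
  by have [[_ _ ->] _ _] := fundamental_tensor_frame i p.
have Fi10 i p : F (E i) E1 E0 p = - (connection i).1.2.
  by have [_ [-> _ _] _] := fundamental_tensor_frame i p.
have Fi11 i p : F (E i) E1 E1 p = - (2 * (connection i).2).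
  by have [_ [_ -> _] _] := fundamental_tensor_frame i p.
have Fi20 i p : F (E i) E2 E0 p = - (connection i).1.1.
  by have [_ _ [-> _ _]] := fundamental_tensor_frame i p.
have Fi22 i p : F (E i) E2 E2 p = 2 * (connection i).2.
  by have [_ _ [_ _ ->]] := fundamental_tensor_frame i p.
move: par; rewrite /class_coefficients; case: s conn => conn /= par.
all: try split; apply: CinftyP => p; rewrite ?(CinftyD, CinftyN) constE.
all: rewrite ?(Fi01, Fi02, Fi10, Fi11, Fi20, Fi22) !conn /=; lra.
Qed.

End Connection.

Theorem theorem2p2 (R : realType) (L : lieGroupType R 3)
    (L_connected : connected (@setT L))
    (E : 'I_3 -> vector_field L)
    (E_basis : left_invariant_basis E)
    (phi : vector_field L -> vector_field L)
    (xi : vector_field L)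
    (eta : vector_field L -> Cinfty L)
    (g : vector_field L -> vector_field L -> Cinfty L)
    (phi_xi_eta_g : apapR_structure E phi xi eta g)
    (nabla : vector_field L -> vector_field L -> vector_field L)
    (nabla_g : levi_civita g nabla)
    (s : basic_class) :
  ((exists c, belongs_to E (fundamental_tensor phi g nabla) s c) <->
   (exists alpha beta, commutators E s alpha beta)) /\
  (forall c alpha beta,
     belongs_to E (fundamental_tensor phi g nabla) s c ->
     commutators E s alpha beta ->
     parameters s c alpha beta).
Proof.
have belP := belongs_toP E_basis phi_xi_eta_g nabla_g s.
have comP := commutatorsP E_basis phi_xi_eta_g nabla_g s.
split=> [|c alpha beta /belP[al [be [par conn]]] /comP conn'].
  split=> [[c /belP[al [be [_ conn]]]]|[al [be /comP conn]]].
    by exists al, be; exact/comP.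
  (* The record inverts [parameters] for all seven classes at once, since each class reads only its
     own fields. *)
  pose c :=
    Coefficients (2 * al) (2 * al) (2 * be) (2 * al) al al (2 * al) be al.
  exists c; apply/belP; exists al, be; split=> //.
  by rewrite /parameters /c; case: (s) => //=; try split; field.
apply: parameters_class_connection par => i.
(* Both pairs of parameters prescribe the same connection. *)
by rewrite -conn -conn'.
Qed.
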